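(* The numbers $\mu_{\mathrm{rack}}$ and $\mu_{\mathrm{qnd}}$ are invariants of digraphs and of graphs: if $\Gamma_1$ and $\Gamma_2$ are isomorphic digraphs (or isomorphic graphs), then $\mu_{\mathrm{rack}}(\Gamma_1)=\mu_{\mathrm{rack}}(\Gamma_2)$ and $\mu_{\mathrm{qnd}}(\Gamma_1)=\mu_{\mathrm{qnd}}(\Gamma_2)$.
   Context: A digraph is a pair $(V,E)$ with $E\subseteq V\times V$ (loops allowed). A graph is a simple undirected graph. $\operatorname{Aut}\Gamma$ denotes the automorphism group of a (di)graph $\Gamma$. A marking of a (di)graph $\Gamma$ with vertex set $V$ is a function $R:V\to\operatorname{Aut}\Gamma$, $v\mapsto R_v$; it realizes the right quasigroup $(V,R)$, i.e. the set $V$ with the permutations $R_v$. The pair $(V,R)$ is a rack if $R_vR_w=R_{R_v(w)}R_v$ for all $v,w\in V$, and a quandle if moreover $R_v(v)=v$ for all $v\in V$. For a (di)graph $\Gamma$, $\mu_{\mathrm{rack}}(\Gamma)$ (resp. $\mu_{\mathrm{qnd}}(\Gamma)$) is the number (cardinality of the set) of markings of $\Gamma$ that realize racks (resp. quandles). *)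

(* Defs.v *)
From mathcomp Require Import all_boot.
From mathcomp Require Import boolp classical_sets functions cardinality.

Set Implicit Arguments.
Unset Strict Implicit.
Unset Printing Implicit Defensive.

Local Open Scope classical_set_scope.

Record digraph := Digraph {
  vertex :> Type;
  edges : set (vertex * vertex)
}.
Arguments edges : clear implicits.

(* An undirected edge {x, y} is encoded by the two arcs (x, y) and (y, x), so
   that an isomorphism of graphs is an isomorphism of the underlying digraphs. *)
Record graph := Graph {
  graph_digraph :> digraph;
  edges_sym : forall x y : graph_digraph,
    edges graph_digraph (x, y) -> edges graph_digraph (y, x);
  edges_irrefl : forall x : graph_digraph, ~ edges graph_digraph (x, x)
}.

Definition is_isomorphism (G H : digraph) (f : G -> H) : Prop :=
  bijective f /\ forall x y : G, edges G (x, y) <-> edges H (f x, f y).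

Definition isomorphic (G H : digraph) : Prop :=
  exists f : G -> H, is_isomorphism f.

(* The second field is a proposition, so by proof irrelevance two automorphisms
   are equal as soon as their underlying maps are. *)
Record Aut (G : digraph) := MkAut {
  aut_fun :> G -> G;
  aut_iso : is_isomorphism aut_fun
}.

Definition marking (G : digraph) : Type := G -> Aut G.

Record right_quasigroup := RightQuasigroup {
  carrier :> Type;
  rtrans : carrier -> carrier -> carrier;
  rtrans_bij : forall v, bijective (rtrans v)
}.

Definition is_rack (Q : right_quasigroup) : Prop :=
  forall v w : Q,
    rtrans v \o rtrans w = rtrans (rtrans v w) \o rtrans v.

Definition is_quandle (Q : right_quasigroup) : Prop :=
  is_rack Q /\ forall v : Q, rtrans v v = v.

Definition realized (G : digraph) (R : marking G) : right_quasigroup :=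
  @RightQuasigroup G (fun v => aut_fun (R v)) (fun v => proj1 (aut_iso (R v))).

(* The vertex set may be infinite, so the numbers mu_rack and mu_qnd are the
   cardinals of the following two sets; equality of these cardinals is [#=]. *)
Definition rack_markings (G : digraph) : set (marking G) :=
  [set R | is_rack (realized R)].

Definition quandle_markings (G : digraph) : set (marking G) :=
  [set R | is_quandle (realized R)].

Arguments rack_markings : clear implicits.
Arguments quandle_markings : clear implicits.

(* Main.v *)
Require Import Defs.
From mathcomp Require Import all_boot.
From mathcomp Require Import boolp classical_sets functions cardinality.

(** An isomorphism [f : G1 -> G2] induces a bijection from the markings of [G1]
    to those of [G2]: conjugate by [f] both the index [v] and the automorphism
    [R_v]. Then [f] is an isomorphism between the two realized right
    quasigroups, so the bijection preserves the rack and quandle axioms. *)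

Local Open Scope card_scope.

Lemma is_isomorphism_comp {G H K : digraph} {f : G -> H} {g : H -> K} :
  is_isomorphism f -> is_isomorphism g -> is_isomorphism (g \o f).
Proof.
move=> [f_bij f_edges] [g_bij g_edges]; split; first exact: bij_comp.
by move=> x y; rewrite f_edges g_edges.
Qed.

Lemma is_isomorphism_inv {G H : digraph} {f : G -> H} {g : H -> G} :
  cancel f g -> cancel g f -> is_isomorphism f -> is_isomorphism g.
Proof.
move=> fK gK [_ f_edges]; split; first by exists f.
by move=> x y; rewrite f_edges !gK.
Qed.

Lemma Aut_ext (G : digraph) (a b : Aut G) : a =1 b -> a = b.
Proof.
case: a b => [a a_iso] [b b_iso] /= /funext eq_ab.
(* Eliminating [eq_ab] with [b_iso] generalized gives both proofs the same type. *)
by case: _ / eq_ab b_iso => b_iso; rewrite (Prop_irrelevance a_iso b_iso).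
Qed.

(** The underlying map, inferred from the proof term, is [f \o a \o g]. *)
Definition conj_aut {G H : digraph} {f : G -> H} {g : H -> G}
    (f_iso : is_isomorphism f) (g_iso : is_isomorphism g) (a : Aut G) : Aut H :=
  MkAut (is_isomorphism_comp g_iso
           (is_isomorphism_comp (aut_iso a) f_iso)).

(** With [g] as an explicit argument, the inverse construction is the same one with [f] and [g]
    exchanged. *)
Definition conj_marking {G H : digraph} {f : G -> H} {g : H -> G}
    (f_iso : is_isomorphism f) (g_iso : is_isomorphism g)
    (R : marking G) : marking H :=
  fun v => conj_aut f_iso g_iso (R (g v)).

Section ConjMarking.
Context {G H : digraph} {f : G -> H} {g : H -> G}.
Hypotheses (fK : cancel f g) (gK : cancel g f).
Variables (f_iso : is_isomorphism f) (g_iso : is_isomorphism g).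

Lemma conj_markingK :
  cancel (conj_marking f_iso g_iso) (conj_marking g_iso f_iso).
Proof.
by move=> R; apply/funext => v; apply: Aut_ext => x /=; rewrite !fK.
Qed.

Lemma conj_marking_rack (R : marking G) :
  rack_markings G R -> rack_markings H (conj_marking f_iso g_iso R).
Proof.
move=> R_rack v w; apply/funext => x /=; rewrite !fK.
(* Once the inner [g (f _)] cancel, both sides are [f] applied to the rack law of [R] at [g v] and
   [g w], evaluated at [g x]. *)
by congr f; have /(congr1 (@^~ (g x))) := R_rack (g v) (g w).
Qed.

Lemma conj_marking_quandle (R : marking G) :
  quandle_markings G R -> quandle_markings H (conj_marking f_iso g_iso R).
Proof.
move=> [R_rack R_idem]; split; first exact: conj_marking_rack.
(* Idempotence at [g v] reduces the goal to [f (g v) = v], which is [gK]. *)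
by move=> v /=; have /= -> := R_idem (g v).
Qed.

End ConjMarking.

(** Mutually inverse maps that send each set into the other restrict to a bijection between the two
    sets. *)
Lemma card_eq_can {T U : Type} {A : set T} {B : set U}
    {f : T -> U} {g : U -> T} :
  cancel f g -> cancel g f ->
  (forall x, A x -> B (f x)) -> (forall y, B y -> A (g y)) -> A #= B.
Proof.
move=> fK gK fAB gBA.
suff f_bij : set_bij A B f by exact: (pcard_eq f_bij).
split=> // [x y _ _|y By]; first exact: can_inj.
by exists (g y); [exact: gBA | exact: gK].
Qed.

Lemma isomorphic_card_markings (G1 G2 : digraph) : isomorphic G1 G2 ->
  rack_markings G1 #= rack_markings G2 /\
  quandle_markings G1 #= quandle_markings G2.
Proof.
move=> [f f_iso]; have [[g fK gK] _] := f_iso.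
have g_iso := is_isomorphism_inv fK gK f_iso.
have FK := conj_markingK fK f_iso g_iso.
have GK := conj_markingK gK g_iso f_iso.
split; apply: (card_eq_can FK GK).
- exact: conj_marking_rack.
- exact: conj_marking_rack.
- exact: conj_marking_quandle.
- exact: conj_marking_quandle.
Qed.

Theorem corollary5p5 :
  (forall G1 G2 : digraph, isomorphic G1 G2 ->
     rack_markings G1 #= rack_markings G2 /\
     quandle_markings G1 #= quandle_markings G2) /\
  (forall G1 G2 : graph, isomorphic G1 G2 ->
     rack_markings G1 #= rack_markings G2 /\
     quandle_markings G1 #= quandle_markings G2).
Proof.
(* Isomorphisms and markings of a graph are those of its underlying digraph, so one lemma covers
   both cases. *)
by split=> G1 G2; exact: isomorphic_card_markings.
Qed.
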